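(* $\mathcal{C}\subsetneq\mathrm{CREG}$, where $\mathcal{C}$ is the smallest family of languages containing all commutative languages with the semilinear property and closed under union and concatenation.
   Context: For $x\in\Sigma^*$, $\Sigma=\{a_1,\dots,a_k\}$, $\Psi(x)=[|x|_{a_1},\dots,|x|_{a_k}]$ (extended to languages). $L$ is commutative if $L=\{x\mid\Psi(x)\in\Psi(L)\}$. $L$ has the linear property if $\Psi(L)=\{\vec c+\sum_{i=1}^q n_i\vec p^{(i)}\mid n_i\ge0\}$ for some $\vec c,\vec p^{(1)},\dots,\vec p^{(q)}\in\mathbb N^k$; it has the semilinear property if it is a finite union of languages with the linear property. Consensual languages: let $\mathring\Sigma=\{\mathring a\mid a\in\Sigma\}$ be a disjoint dotted copy and $\widetilde\Sigma=\Sigma\cup\mathring\Sigma$. The match on letters is $a@\mathring a=\mathring a@a=a$, $\mathring a@\mathring a=\mathring a$, undefined otherwise; on words of equal length it is applied letterwise and is defined iff every position is defined ($\epsilon@\epsilon=\epsilon$), undefined for unequal lengths; on languages $B_1@B_2=\{w_1@w_2\mid w_1\in B_1,w_2\in B_2,\ w_1@w_2\text{ defined}\}$. $B^{0@}=B$, $B^{i@}=B^{(i-1)@}@B$, $B^@=\bigcup_{i\ge0}B^{i@}$, and $\mathcal{C}(B)=B^@\cap\Sigma^*$. CREG (consensually regular languages) is the family of all $\mathcal{C}(B)$ with $B\subseteq\widetilde\Sigma^*$ regular. *)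

(* Defs.v *)
From mathcomp Require Import all_boot.
Set Implicit Arguments. Unset Strict Implicit. Unset Printing Implicit Defensive.

Definition lang (S : Type) := seq S -> Prop.

Definition parikh (S : finType) (x : seq S) : {ffun S -> nat} :=
  [ffun a => count_mem a x].

Definition commutative (S : finType) (L : lang S) : Prop :=
  forall x, L x <-> exists y, L y /\ parikh y = parikh x.

Definition linear_prop (S : finType) (L : lang S) : Prop :=
  exists (c : {ffun S -> nat}) (q : nat) (p : 'I_q -> {ffun S -> nat}),
    forall v : {ffun S -> nat},
      (exists x, L x /\ parikh x = v) <->
      (exists n : 'I_q -> nat, v = [ffun a => c a + \sum_(i < q) n i * p i a]).

Definition semilinear_prop (S : finType) (L : lang S) : Prop :=
  exists (m : nat) (Ls : 'I_m -> lang S),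
    (forall x, L x <-> exists i, Ls i x) /\ (forall i, linear_prop (Ls i)).

Inductive inC (S : finType) : lang S -> Prop :=
  | inC_base (L : lang S) : commutative L -> semilinear_prop L -> inC L
  | inC_union (L1 L2 L : lang S) : inC L1 -> inC L2 ->
      (forall x, L x <-> L1 x \/ L2 x) -> inC L
  | inC_cat (L1 L2 L : lang S) : inC L1 -> inC L2 ->
      (forall x, L x <-> exists x1 x2, L1 x1 /\ L2 x2 /\ x = x1 ++ x2) -> inC L.

Definition regular (A : finType) (B : lang A) : Prop :=
  exists (n : nat) (s : 'I_n) (d : 'I_n -> A -> 'I_n) (F : pred 'I_n),
    forall w, B w <-> F (foldl d s w).

(* Dotted alphabet: inl a = a (undotted), inr a = dotted a. *)
Definition dalpha (S : finType) : finType := (S + S)%type.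

Definition match_letter (S : finType) (u v : S + S) : option (S + S) :=
  match u, v with
  | inl a, inr b => if a == b then Some (inl a) else None
  | inr a, inl b => if a == b then Some (inl b) else None
  | inr a, inr b => if a == b then Some (inr a) else None
  | inl _, inl _ => None
  end.

Fixpoint match_word (S : finType) (w1 w2 : seq (S + S)) : option (seq (S + S)) :=
  match w1, w2 with
  | [::], [::] => Some [::]
  | u :: w1', v :: w2' =>
      match match_letter u v, match_word w1' w2' with
      | Some c, Some w => Some (c :: w)
      | _, _ => None
      end
  | _, _ => None
  end.

Definition match_lang (S : finType) (B1 B2 : lang (S + S)) : lang (S + S) :=
  fun w => exists w1 w2, B1 w1 /\ B2 w2 /\ match_word w1 w2 = Some w.

Fixpoint match_pow (S : finType) (B : lang (S + S)) (i : nat) : lang (S + S) :=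
  match i with
  | 0 => B
  | i'.+1 => match_lang (match_pow B i') B
  end.

Definition match_star (S : finType) (B : lang (S + S)) : lang (S + S) :=
  fun w => exists i, match_pow B i w.

Definition consensual (S : finType) (B : lang (S + S)) : lang S :=
  fun x => match_star B (map inl x).

Definition CREG (S : finType) (L : lang S) : Prop :=
  exists B : lang (dalpha S), regular B /\ forall x, L x <-> consensual B x.

(* Main.v *)
Require Import Defs.
From mathcomp Require Import all_boot.
From mathcomp Require Import boolp zify.
Set Implicit Arguments. Unset Strict Implicit. Unset Printing Implicit Defensive.

(** A word lies in C(B) iff its positions can be shared out among words of B so
    that each position is undotted ("owned") in exactly one of them.

    Inclusion.  A language of the family is a finite union of concatenations of
    commutative linear languages.  Each linear factor [i] gets its own residue
    modulo [m].  The base contains fillers of type [i], owning only full blocks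
    of length [m] that start at positions congruent to the residue of [i], with
    a bounded Parikh vector in the cone of the periods of [i]; and leaders,
    which own position 0, guess the factorization, and inside factor [i] leave
    dotted only full blocks aligned at the residue of [i].  Alignment forces
    every block left free in factor [i] to be owned by a filler of type [i]:
    changing residue would require an owned segment of length not divisible by
    [m], and only the unique leader has these.  Conversely, by Dickson's lemma
    the multiset of blocks of a word of factor [i] splits into boundedly large
    groups, each with total in the cone, plus one bounded group for the leader.

    Strictness.  In a language of the family, every long word has two adjacent
    letters whose exchange stays in the language; this fails for the regular
    language of prefixes of (ab)^*. *)


(** * Regular languages *)

Section Regular.
Variable A : finType.
Implicit Types (B : lang A) (w : seq A).

(** The state is given as a function [f] of the word read so far that can be updated letter by
    letter, so the later automata are specified by what they remember. *)
Lemma regular_fold (Q : finType) (f : seq A -> Q) (d : Q -> A -> Q) (F : pred Q)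
    B :
  (forall w a, f (rcons w a) = d (f w) a) -> (forall w, B w <-> F (f w)) ->
  regular B.
Proof.
move=> fE BE; exists #|Q|, (enum_rank (f [::])).
exists (fun i a => enum_rank (d (enum_val i) a)), (fun i => F (enum_val i)) => w.
rewrite BE; suff -> : foldl (fun i a => enum_rank (d (enum_val i) a))
  (enum_rank (f [::])) w = enum_rank (f w) by rewrite enum_rankK.
by elim/last_ind: w => // w a IH; rewrite foldl_rcons IH enum_rankK fE.
Qed.

Lemma eq_regular B1 B2 : (forall w, B2 w <-> B1 w) -> regular B1 -> regular B2.
Proof.
by move=> E [n [s [d [F H]]]]; exists n, s, d, F => w; rewrite E.
Qed.

Lemma regular_or B1 B2 :
  regular B1 -> regular B2 -> regular (fun w => B1 w \/ B2 w).
Proof.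
move=> [n1 [s1 [d1 [F1 H1]]]] [n2 [s2 [d2 [F2 H2]]]].
apply: (@regular_fold _ (fun w => (foldl d1 s1 w, foldl d2 s2 w))
  (fun q a => (d1 q.1 a, d2 q.2 a)) (fun q => F1 q.1 || F2 q.2)) => [w a|w] /=.
  by rewrite !foldl_rcons.
by rewrite H1 H2; split=> /orP.
Qed.

Lemma regular_and B1 B2 :
  regular B1 -> regular B2 -> regular (fun w => B1 w /\ B2 w).
Proof.
move=> [n1 [s1 [d1 [F1 H1]]]] [n2 [s2 [d2 [F2 H2]]]].
apply: (@regular_fold _ (fun w => (foldl d1 s1 w, foldl d2 s2 w))
  (fun q a => (d1 q.1 a, d2 q.2 a)) (fun q => F1 q.1 && F2 q.2)) => [w a|w] /=.
  by rewrite !foldl_rcons.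
by rewrite H1 H2; split=> /andP.
Qed.

Lemma regular_false : regular (fun _ : seq A => False).
Proof. by exists 1, ord0, (fun _ _ => ord0), pred0. Qed.

Lemma regular_exists_in (T : eqType) (L : T -> lang A) (s : seq T) :
  (forall t, regular (L t)) -> regular (fun w => exists2 t, t \in s & L t w).
Proof.
move=> HL; elim: s => [|t s IH].
  by apply: eq_regular regular_false => w; split=> // -[].
apply: eq_regular (regular_or (HL t) IH) => w; split.
  by move=> [u]; rewrite inE => /predU1P[-> ?|us Lu]; [left|right; exists u].
by move=> [?|[u us Lu]]; [exists t; rewrite ?mem_head|exists u; rewrite // inE us orbT].
Qed.

Lemma regular_exists (T : finType) (L : T -> lang A) :
  (forall t, regular (L t)) -> regular (fun w => exists t, L t w).
Proof.
move=> /regular_exists_in-/(_ (enum T)); apply: eq_regular => w.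
by split=> [[t Lt]|[t _ Lt]]; exists t; rewrite ?mem_enum.
Qed.

(** Subset construction: [X w] collects the states of the second automaton over all cuts of [w]
    whose left part the first one accepts. *)
Lemma regular_cat B1 B2 : regular B1 -> regular B2 ->
  regular (fun w => exists w1 w2, [/\ w = w1 ++ w2, B1 w1 & B2 w2]).
Proof.
move=> [n1 [s1 [d1 [F1 H1]]]] [n2 [s2 [d2 [F2 H2]]]].
pose X w := [set q | has (fun i => F1 (foldl d1 s1 (take i w)) &&
  (foldl d2 s2 (drop i w) == q)) (iota 0 (size w).+1)].
apply: (@regular_fold _ (fun w => (foldl d1 s1 w, X w))
  (fun q a => (d1 q.1 a, [set d2 x a | x in q.2] :|:
                  (if F1 (d1 q.1 a) then [set s2] else set0)))
  (fun q => [exists x in q.2, F2 x])) => [w a|w] /=.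
  rewrite foldl_rcons; congr pair; apply/setP=> q; rewrite !inE.
  have iotaS n : iota 0 n.+1 = rcons (iota 0 n) n by rewrite -addn1 iotaD cats1.
  rewrite iotaS has_rcons orbC take_size drop_size foldl_rcons size_rcons.
  congr orb; last by case: ifP; rewrite !inE //= eq_sym.
  apply/hasP/imsetP => [[i]|[x]].
    rewrite mem_iota add0n ltnS => /andP[_ iw] /andP[Fi /eqP <-].
    exists (foldl d2 s2 (drop i w)).
      rewrite inE; apply/hasP; exists i; first by rewrite mem_iota add0n ltnS.
      by rewrite eqxx andbT -(takel_cat [:: a] iw) cats1.
    by rewrite drop_rcons // foldl_rcons.
  rewrite inE => /hasP[i]; rewrite mem_iota add0n ltnS => /andP[_ iw].
  move=> /andP[Fi /eqP <-] ->; exists i; first by rewrite mem_iota add0n ltnS.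
  by rewrite drop_rcons // foldl_rcons eqxx andbT -cats1 takel_cat.
split.
  move=> [w1 [w2 [-> /H1 F1w /H2 F2w]]]; apply/existsP; exists (foldl d2 s2 w2).
  rewrite F2w andbT inE; apply/hasP; exists (size w1).
    by rewrite mem_iota add0n ltnS size_cat leq_addr.
  by rewrite take_size_cat // drop_size_cat // F1w eqxx.
move=> /existsP[x]; rewrite inE => /andP[/hasP[i _ /andP[Fi /eqP <-]] F2i].
exists (take i w), (drop i w); rewrite cat_take_drop; split=> //; first exact/H1.
exact/H2.
Qed.

Lemma regular_size (m k : nat) : regular (fun w => size w %% m.+1 = k).
Proof.
apply: (@regular_fold _ (fun w => inord (size w %% m.+1) : 'I_m.+1)
  (fun q _ => inord (q.+1 %% m.+1)) (fun q => q == k :> nat)) => [w a|w].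
  rewrite size_rcons inordK ?ltn_mod //; congr inord.
  by rewrite -[in RHS]addn1 modnDml addn1.
by rewrite inordK ?ltn_mod //; split=> /eqP.
Qed.

(** Inside a word placed at offset [e], the set [D] is a union of blocks of [m]
    positions starting at positions [= r %[mod m]]; as [nth] with default [false]
    vanishes past the end, blocks cut by either end of the word are excluded. *)
Definition aligned (m r e : nat) (D : nat -> bool) : Prop :=
  forall p, (e + p) %% m != r -> D p = if p is p'.+1 then D p' else false.

(** Alignment compares each position only with its predecessor, so the position modulo [m.+1], the
    last bit and a flag suffice. The final test is the comparison at position [size w], where the
    set has become [false]. *)
Lemma regular_aligned (P : pred A) (m r e : nat) :
  regular (fun w => aligned m.+1 r e (nth false (map P w))).
Proof.
pose D w := nth false (map P w).
pose c w p := ((e + p) %% m.+1 == r) || (D w p == if p is p'.+1 then D w p' else false).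
pose lst w := last false (map P w).
have lstE w : lst w = (if size w is p'.+1 then D w p' else false).
  rewrite /lst /D; case/lastP: w => // w b.
  by rewrite map_rcons last_rcons size_rcons nth_rcons size_map ltnn eqxx.
apply: (@regular_fold _
  (fun w => (inord ((e + size w) %% m.+1) : 'I_m.+1, lst w, all (c w) (iota 0 (size w))))
  (fun q a => (inord (q.1.1.+1 %% m.+1), P a,
     q.2 && ((q.1.1 == r :> nat) || (P a == q.1.2))))
  (fun q => q.2 && ((q.1.1 == r :> nat) || ~~ q.1.2))) => [w a|w] /=.
  rewrite size_rcons inordK ?ltn_mod //; congr (_, _, _).
  - by congr inord; rewrite addnS -[in RHS]addn1 modnDml addn1.
  - by rewrite /lst map_rcons last_rcons.
  rewrite -[(size w).+1]addn1 iotaD all_cat /= add0n andbT; congr andb.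
    apply: eq_in_all => p; rewrite mem_iota add0n => /andP[_ pw].
    rewrite /c /D map_rcons !nth_rcons size_map pw; congr (_ || (_ == _)).
    by case: p pw => // p /ltnW pw; rewrite nth_rcons size_map pw.
  rewrite /c lstE /D map_rcons nth_rcons size_map ltnn eqxx; congr (_ || (_ == _)).
  case: (size w) (size_map P w) => // k sk.
  by rewrite nth_rcons sk leqnn.
have DF p : size w <= p -> D w p = false by move=> h; rewrite /D nth_default // size_map.
rewrite inordK ?ltn_mod //; split.
  move=> al; apply/andP; split.
    by apply/allP => p _; rewrite /c; case: eqP => //= /eqP /al; rewrite /D => ->.
  by case: eqP => //= /eqP /al; rewrite lstE -/(D w) => <-; rewrite DF.
move=> /andP[/allP ok fin] p np; rewrite -/(D w).
have [pw|pw|pw] := ltngtP p (size w).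
- by have := ok p; rewrite mem_iota add0n pw /c (negPf np) => /(_ isT) /eqP.
- rewrite DF ?(ltnW pw) //; case: p pw {np} => // p; rewrite ltnS => pw.
  by rewrite DF.
- by rewrite pw DF // -lstE; move: fin; rewrite -pw (negPf np) => /negPf.
Qed.

End Regular.


(** * Consensual languages as partitions of positions *)

Section Words.
Variable S : finType.
Implicit Types (x : seq S) (w : seq (S + S)) (a : S).

Definition owned (l : S + S) : bool := if l is inl _ then true else false.
Definition letter (l : S + S) : S := match l with inl a | inr a => a end.
Definition own w : nat -> bool := nth false (map owned w).

Fixpoint mark x (D : nat -> bool) : seq (S + S) :=
  if x is a :: x' then
    (if D 0 then inl a else inr a) :: mark x' (fun p => D p.+1)
  else [::].

Lemma letter_mark x D : map letter (mark x D) = x.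
Proof. by elim: x D => //= a x IH D; rewrite IH; case: (D 0). Qed.

Lemma size_mark x D : size (mark x D) = size x.
Proof. by rewrite -[in RHS](letter_mark x D) size_map. Qed.

Lemma own_mark x D p : own (mark x D) p = D p && (p < size x).
Proof.
rewrite /own; elim: x D p => [|a x IH] D p /=; first by rewrite nth_nil andbF.
by case: p => [|p] /=; [case: (D 0)|exact: (IH (fun p => D p.+1))].
Qed.

Lemma own_default w p : size w <= p -> own w p = false.
Proof. by move=> h; rewrite /own nth_default // size_map. Qed.

Lemma own_lt w p : own w p -> p < size w.
Proof. by apply: contraLR; rewrite -leqNgt => /own_default ->. Qed.

Lemma own_cat w1 w2 p :
  own (w1 ++ w2) p = if p < size w1 then own w1 p else own w2 (p - size w1).
Proof. by rewrite /own map_cat nth_cat size_map. Qed.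

Lemma count_own w a : count_mem (inl a) w =
  \sum_(0 <= p < size w) (own w p && (onth (map letter w) p == Some a)).
Proof.
elim: w => [|l w IH]; first by rewrite big_geq.
rewrite big_nat_recl //= IH; congr addn.
by case: l => b /=; rewrite /own /= ?andFb.
Qed.

Lemma count_own_le w a n : size w <= n -> count_mem (inl a) w =
  \sum_(0 <= p < n) (own w p && (onth (map letter w) p == Some a)).
Proof.
move=> wn; rewrite count_own [in RHS](big_cat_nat (n := size w) (m := 0)) //=.
rewrite [X in (_ + X)%N]big_nat_cond [X in (_ + X)%N]big1 ?addn0 // => p.
move=> /andP[/andP[wp _] _]; by rewrite own_default.
Qed.

(** With booleans read as numbers, the sum forbids a position undotted in both words, where the
    match is undefined, and says that the match owns the union. *)
Lemma match_wordP w1 w2 w :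
  match_word w1 w2 = Some w <->
  [/\ map letter w1 = map letter w, map letter w2 = map letter w &
      forall p, own w1 p + own w2 p = own w p].
Proof.
elim: w1 w2 w => [|u w1 IH] [|v w2] [|l w] /=; try by split=> // -[].
  by split=> // _; split=> // p; rewrite /own /= !nth_nil.
  by case: (match_letter u v) (match_word w1 w2) => [?|] // [?|] //; split=> // -[].
split.
  case E1: (match_letter u v) => [c|] //; case E2: (match_word w1 w2) => [z|] // [<- <-].
  have [-> -> H] := (IH _ _).1 E2.
  by case: u v E1 => [b|b] [b'|b'] //=; case: eqP => //= -> [<-] /=; split=> // -[|p] //=;
    exact: H.
move=> [[E1 E2] [E3 E4] H].
have -> : match_word w1 w2 = Some w by apply/IH; split=> // p; exact: (H p.+1).
move: (H 0) E1 E3 => {H}; rewrite /own /=.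
by case: u v l => [b|b] [b'|b'] [b2|b2] //= _ -> ->; rewrite eqxx.
Qed.

Lemma match_powP (B : lang (S + S)) i w :
  match_pow B i w <->
  exists ws, [/\ size ws = i.+1,
    forall v, v \in ws -> B v /\ map letter v = map letter w &
    forall p, count (fun v => own v p) ws = own w p].
Proof.
elim: i w => [|i IH] w /=.
  split=> [Bw|[[|v [|v1 ws]] [//= _ Bv C]]].
    exists [:: w]; split=> // [v|p /=]; last by rewrite addn0.
    by rewrite inE => /eqP ->.
  have [Bv' E] := Bv v (mem_head _ _).
  suff -> : w = v by [].
  have {}C p : own v p = own w p.
    by have /= := C p; rewrite addn0; case: (own v p) (own w p) => [] [].
  elim: v w E C {Bv Bv'} => [|l v IHv] [|l' w] //= [E1 E2] C.
  move: (C 0); rewrite /own /= => E3; congr cons.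
    by move: E1 E3; clear; case: l l' => [b|b] [b'|b'] //= ->.
  by apply: IHv => // p; exact: (C p.+1).
split=> [[w1 [w2 [/IH[ws [sws Bws C]] [Bw2 /match_wordP[E1 E2 H]]]]]|].
  exists (w2 :: ws); split=> [|v|p] /=; first by rewrite sws.
    rewrite inE => /predU1P[->//|/Bws[? ->]]; split=> //.
  by rewrite C -H addnC.
move=> [[|w2 ws] [//= [sws] Bws C]].
(* The match of the words other than [w2] owns exactly what they own together. *)
exists (mark (map letter w) (fun p => has (fun v => own v p) ws)), w2; split.
  apply/IH; exists ws; split=> // [v vws|p].
    by rewrite letter_mark; apply: Bws; rewrite inE vws orbT.
  rewrite own_mark has_count size_map; have /= := C p.
  case: (ltnP p (size w)) => [_|/own_default ->]; last by rewrite andbF; lia.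
  by case: (own w p); rewrite andbT; case: (count _ _) => [|[|n]]; case: (own w2 p).
have [Bw2 E] := Bws w2 (mem_head _ _); split=> //; apply/match_wordP.
split=> // [|p]; rewrite ?letter_mark //.
rewrite own_mark has_count size_map; have /= := C p.
case: (ltnP p (size w)) => [_|/own_default ->]; last by rewrite andbF; lia.
by case: (own w p); rewrite andbT; case: (count _ _) => [|[|n]]; case: (own w2 p).
Qed.

(** At least one word is required because the zeroth power of the base is the base itself; this
    matters only when [x] is empty. *)
Lemma consensualP (B : lang (S + S)) x :
  consensual B x <->
  exists ws, [/\ ws <> [::],
    forall v, v \in ws -> B v /\ map letter v = x &
    forall p, count (fun v => own v p) ws = (p < size x)].
Proof.
have lx : map letter (map inl x) = x by rewrite -map_comp map_id.
have ox p : own (map inl x) p = (p < size x).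
  rewrite /own -map_comp; case: ltnP => px; last by rewrite nth_default ?size_map.
  by case: x px {lx} => // a x px; rewrite (nth_map a).
split=> [[i /match_powP[ws [sws Bws C]]]|[ws [nws Bws C]]].
  exists ws; split=> [E|v /Bws|p]; [by rewrite E in sws|by rewrite lx|by rewrite C ox].
exists (size ws).-1; apply/match_powP; exists ws; split=> [|v|p].
- by case: ws nws {Bws C}.
- by rewrite lx; exact: Bws.
- by rewrite ox.
Qed.

End Words.

Arguments owned {S} l.
Arguments letter {S} l.
Arguments own {S} w.


(** * Parikh vectors of owned letters *)

Section Counting.
Variable S : finType.
Implicit Types (x : seq S) (w : seq (S + S)) (a : S).

Definition pown w : {ffun S -> nat} := [ffun a => count_mem (inl a) w].

Lemma pown_sum w n a : size w <= n -> pown w a =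
  \sum_(0 <= p < n) own w p * (onth (map letter w) p == Some a).
Proof.
move=> wn; rewrite ffunE (count_own_le _ wn).
by apply: eq_bigr => p _; rewrite mulnb.
Qed.

Lemma count_onth x a :
  count_mem a x = \sum_(0 <= p < size x) (onth x p == Some a).
Proof.
elim: x => [|b x IH]; first by rewrite big_geq.
by rewrite big_nat_recl //= IH.
Qed.

(** Double counting: each position contributes its letter through its only owner. The map [h] lets
    the owners be restrictions of given words. *)
Lemma count_cover (T : eqType) (h : T -> seq (S + S)) (vs : seq T) x a :
  (forall v, v \in vs -> map letter (h v) = x) ->
  (forall p, p < size x -> count (fun v => own (h v) p) vs = 1) ->
  count_mem a x = \sum_(v <- vs) pown (h v) a.
Proof.
move=> L C; rewrite count_onth.
rewrite [RHS](eq_big_seq (fun v => \sum_(0 <= p < size x)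
  own (h v) p * (onth x p == Some a))); last first.
  by move=> v /L <-; rewrite (@pown_sum _ (size (h v))) ?size_map.
rewrite exchange_big /=; apply: eq_big_nat => p /andP[_ px].
rewrite -big_distrl /= -[LHS]mul1n; congr muln.
by rewrite -(C p px) -sum1_count big_mkcond; apply: eq_bigr => v _; case: own.
Qed.

Lemma pown0 w a : (forall p, own w p = false) -> pown w a = 0.
Proof.
by move=> H; rewrite (@pown_sum w (size w)) // big1 // => p _; rewrite H.
Qed.

Lemma pown_cat w1 w2 a : pown (w1 ++ w2) a = pown w1 a + pown w2 a.
Proof. by rewrite !ffunE count_cat. Qed.

Lemma own_take k w p : own (take k w) p = (p < k) && own w p.
Proof.
rewrite /own map_take; case: ltnP => kp; first by rewrite nth_take.
by rewrite nth_default // size_take_min geq_min kp.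
Qed.

Lemma own_drop k w p : own (drop k w) p = own w (k + p).
Proof. by rewrite /own map_drop nth_drop. Qed.

Lemma pown_segment e k w a : (forall p, own w p -> e <= p < e + k) ->
  pown (take k (drop e w)) a = pown w a.
Proof.
move=> H; rewrite -[in RHS](cat_take_drop e w) -[in RHS](cat_take_drop k (drop e w)).
rewrite !pown_cat [pown (take e w) a]pown0 => [|p].
  rewrite [pown (drop k _) a]pown0 ?addn0 // => p.
  by rewrite !own_drop; apply/negP=> /H; lia.
by rewrite own_take; apply/negP=> /andP[pe /H]; lia.
Qed.

End Counting.

(** * Leaders and fillers *)

Section Lin.
Variable S : finType.

Record lin := Lin {
  lc : {ffun S -> nat};
  lq : nat;
  lp : 'I_lq -> {ffun S -> nat} }.

Definition comb (l : lin) (n : 'I_(lq l) -> nat) (a : S) : nat :=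
  \sum_i n i * lp i a.

Definition cone (l : lin) (v : {ffun S -> nat}) : Prop :=
  exists n : 'I_(lq l) -> nat, forall a, v a = comb n a.

Definition affine (l : lin) (v : {ffun S -> nat}) : Prop :=
  exists n : 'I_(lq l) -> nat, forall a, v a = lc l a + comb n a.

Lemma comb_add (l : lin) (n1 n2 : 'I_(lq l) -> nat) a :
  comb (fun i => n1 i + n2 i) a = comb n1 a + comb n2 a.
Proof. by rewrite /comb -big_split; apply: eq_bigr => i _; rewrite /= mulnDl. Qed.

Lemma affine_add (l : lin) (u v w : {ffun S -> nat}) :
  affine l u -> cone l v -> (forall a, w a = u a + v a) -> affine l w.
Proof.
move=> [n1 E1] [n2 E2] E; exists (fun i => n1 i + n2 i) => a.
by rewrite comb_add E E1 E2 addnA.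
Qed.

Lemma cone_sum (T : eqType) (l : lin) (s : seq T) (P : pred T)
    (v : T -> {ffun S -> nat}) :
  (forall t, t \in s -> P t -> cone l (v t)) ->
  cone l [ffun a => \sum_(t <- s | P t) v t a].
Proof.
elim: s => [|t s IH] H.
  by exists (fun=> 0) => a; rewrite ffunE big_nil /comb big1.
have [|n En] := IH; first by move=> u us; apply: H; rewrite inE us orbT.
case Pt: (P t); last by exists n => a; rewrite -En !ffunE big_cons Pt.
have [n1 E1] := H t (mem_head _ _) Pt.
exists (fun i => n1 i + n i) => a.
by rewrite comb_add -En -E1 !ffunE big_cons Pt.
Qed.

Definition linlang (l : lin) : lang S := fun x => affine l (parikh x).

Fixpoint catlang (I : Type) (lam : I -> lin) (s : seq I) : lang S :=
  if s is i :: s' then fun x => exists x1 x2,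
    [/\ x = x1 ++ x2, linlang (lam i) x1 & catlang lam s' x2]
  else fun x => x = [::].

End Lin.

Section Base.
Variables (S I : finType) (lam : I -> lin S) (N : I -> nat).
Implicit Types (w : seq (S + S)) (i : I) (s : seq I).

Let m := #|I|.+1.
(** Residues start at 1, so that no filler can own position 0. *)
Definition res i : nat := (enum_rank i).+1.

Lemma res_inj : injective res.
Proof. by move=> i j [] /ord_inj /enum_rank_inj. Qed.

(** This is not the complement of [own]: past the end both are [false], so alignment also rules out
    a dotted block cut by the end of a phase. *)
Definition dotted w : nat -> bool := nth false (map (predC owned) w).

Lemma dottedE w p : dotted w p = (p < size w) && ~~ own w p.
Proof.
rewrite /dotted /own; elim: w p => [|l w IH] [|p] //=.
Qed.

(** The bound leaves finitely many Parikh vectors, so that a finite automaton can test membership in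
    a cone. *)
Definition bounded i w := forall a, pown w a < N i.

(** Positivity keeps the empty word from being a filler, so that the empty input is accepted only
    through a leader. *)
Definition fill i (e : nat) w : Prop :=
  [/\ bounded i w, cone (lam i) (pown w), exists a, 0 < pown w a &
      aligned m (res i) e (own w)].

Definition phase i (e : nat) w : Prop :=
  [/\ bounded i w, affine (lam i) (pown w) & aligned m (res i) e (dotted w)].

Fixpoint leader s (e : nat) w : Prop :=
  if s is i :: s' then exists w1 w2,
    [/\ w = w1 ++ w2, phase i e w1 & leader s' (e + size w1) w2]
  else w = [::].

Definition base (ts : seq (seq I)) : lang (S + S) := fun w =>
  (exists2 s, s \in ts & leader s 0 w) \/ (exists i, fill i 0 w).

(** * Soundness: fillers respect the factors guessed by the leader *)

Section Soundness.
Variables (gs : seq (I * seq (S + S))) (x : seq S).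
Hypothesis fill_gs : forall g, g \in gs -> fill g.1 0 g.2.
Hypothesis letter_gs : forall g, g \in gs -> map letter g.2 = x.

(** No filler owns a block that straddles position [e]. *)
Definition clean (e : nat) := forall g, g \in gs -> own g.2 e -> res g.1 = e %% m.

Definition covers (e : nat) w := forall p, p < size w ->
  own w p + count (fun g => own g.2 (e + p)) gs = 1.

Lemma owner_unique p g h : count (fun g => own g.2 p) gs <= 1 ->
  g \in gs -> h \in gs -> own g.2 p -> own h.2 p -> g = h.
Proof.
elim: gs => //= k ks IH; rewrite !inE => C.
have zero q : count (fun g0 : I * seq (S + S) => own g0.2 p) ks = 0 ->
    q \in ks -> own q.2 p -> False.
  move=> /eqP; rewrite eqn0Ngt -has_count => /hasPn H /H; by case: own.
move=> /predU1P[->|gk] /predU1P[->|hk] // og oh.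
- by case: (@zero h) => //; move: C; rewrite og; lia.
- by case: (@zero g) => //; move: C; rewrite oh; lia.
- by apply: IH => //; move: C; lia.
Qed.

(** Induction on [p]. Where a block of residue [res i] may start, an owner of another type would
    also own the previous position, against the induction hypothesis. Elsewhere the previous
    position is dotted too, its owner has type [i], and alignment carries that owner on to the
    current position, where owners are unique. *)
Lemma phase_owner i e w : aligned m (res i) e (dotted w) -> covers e w ->
  clean e ->
  (forall p, p < size w -> forall g, g \in gs -> own g.2 (e + p) -> g.1 = i) /\
  clean (e + size w).
Proof.
move=> al cov cl.
have free p g : p < size w -> g \in gs -> own g.2 (e + p) -> dotted w p.
  move=> pw gg og; rewrite dottedE pw /=; have := cov p pw; case: (own w p) => //.
  suff : 0 < count (fun g => own g.2 (e + p)) gs by lia.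
  by rewrite -has_count; apply/hasP; exists g.
have back g p : g \in gs -> own g.2 p -> p %% m != res g.1 ->
    if p is p'.+1 then own g.2 p' else false.
  by move=> /fill_gs[_ _ _ ag] og /ag <-.
have step p : p < size w -> forall g, g \in gs -> own g.2 (e + p) -> g.1 = i.
  elim: p => [|p IH] pw g gg og.
    have D := free 0 g pw gg og; apply: res_inj.
    rewrite addn0 in og; rewrite (cl g gg og); apply/eqP.
    by apply: contraT => ne; move: (al 0); rewrite addn0 D => /(_ ne).
  have D := free _ g pw gg og.
  have [E|ne] := eqVneq ((e + p.+1) %% m) (res i).
    apply/eqP; apply: contraT => gi.
    have /= := back g (e + p).+1 gg; rewrite -addnS E => /(_ og) og'.
    have {}og' : own g.2 (e + p) by apply: og'; apply: contraNneq gi => /res_inj ->.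
    by rewrite (IH (ltnW pw) g gg og') eqxx in gi.
  have /esym := al _ ne; rewrite D dottedE => /andP[pw' nop].
  have : 0 < count (fun g => own g.2 (e + p)) gs.
    by have := cov p pw'; rewrite (negPf nop); lia.
  rewrite -has_count => /hasP[h hg oh].
  have hi := IH pw' h hg oh.
  suff -> : g = h by [].
  apply: (@owner_unique (e + p.+1)) => //.
    by have := cov _ pw; lia.
  have [_ _ _ ah] := fill_gs hg.
  by rewrite ah ?hi // addnS.
(* A filler crossing the end of a non-empty [w] inside a block would own the last position and so
   have type [i]; alignment of the dotted set would then continue it past the end, where [dotted] is
   [false]. *)
split=> // g gg og; apply/eqP; apply: contraT; rewrite eq_sym => ne.
case Ew: (size w) => [|k].
  by move: og ne; rewrite Ew addn0 => og; rewrite (cl g gg og) eqxx.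
have ok := back g _ gg og ne; rewrite Ew addnS in ok.
have kw : k < size w by rewrite Ew.
have gi := step k kw g gg ok.
have := al (size w); rewrite Ew => /(_ _).
rewrite (free _ _ kw gg ok) dottedE Ew ltnn /= => /(_ _).
by rewrite -Ew -gi => /(_ ne).
Qed.

Lemma covers_cat e w1 w2 :
  covers e (w1 ++ w2) -> covers e w1 /\ covers (e + size w1) w2.
Proof.
move=> C; split=> p pw.
  by have := C p; rewrite size_cat own_cat pw ltn_addr // => /(_ isT).
have := C (size w1 + p); rewrite size_cat own_cat ltn_add2l pw => /(_ isT).
by rewrite ltnNge leq_addr /= addKn addnA.
Qed.

Lemma leader_owner s e w : leader s e w -> covers e w -> clean e ->
  forall g p, g \in gs -> e <= p < e + size w -> own g.2 p -> g.1 \in s.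
Proof.
elim: s e w => [|i s IH] e w /=.
  by move=> -> _ _ g p _; rewrite addn0; lia.
move=> [w1 [w2 [-> [_ _ al] Ld]]] /covers_cat[C1 C2] cl g p gg.
have [own1 cl2] := phase_owner al C1 cl.
rewrite size_cat => /andP[ep pe] og; have [p1|p1] := ltnP (p - e) (size w1).
  by rewrite (own1 _ p1 g) ?mem_head // subnKC.
by rewrite inE (IH _ _ Ld C2 cl2 g p) ?orbT //; lia.
Qed.

(** Induction on the phases, with the invariant that fillers of a type still to come own nothing
    before [e]. As the types in [s] are distinct, all fillers of type [i] then lie inside factor
    [i]. *)
Lemma leader_sound s e w : uniq s -> leader s e w -> covers e w -> clean e ->
  (forall g, g \in gs -> g.1 \in s -> forall p, p < e -> own g.2 p = false) ->
  map letter w = drop e x -> size x = e + size w ->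
  catlang lam s (drop e x).
Proof.
elim: s e w => [|i s IH] e w /=.
  by move=> _ -> _ _ _ <-.
move=> /andP[nis us] [w1 [w2 [-> [_ aff al] Ld]]] /covers_cat[C1 C2] cl low.
have [own1 cl2] := phase_owner al C1 cl.
rewrite map_cat size_cat => Ex sx.
have E1 : take (size w1) (drop e x) = map letter w1.
  by rewrite -Ex take_size_cat ?size_map.
have E2 : drop (e + size w1) x = map letter w2.
  by rewrite addnC -drop_drop -Ex drop_size_cat ?size_map.
exists (take (size w1) (drop e x)), (drop (e + size w1) x); split.
- by rewrite E1 E2.
(* The owners of the first factor: [None] stands for the leader's phase [w1], [Some g] for the part
   of [g] inside the factor. Fillers of type [i] count in full, all others contribute nothing. *)
- pose vs : seq (option (I * seq (S + S))) := None :: map Some gs.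
  pose h (v : option (I * seq (S + S))) :=
    if v is Some g then take (size w1) (drop e g.2) else w1.
  have cn : cone (lam i) [ffun a => \sum_(g <- gs | g.1 == i) pown g.2 a].
    apply: (@cone_sum _ _ _ gs (fun g => g.1 == i) (fun g => pown g.2)) => g gg.
    by move=> /eqP <-; have [] := fill_gs gg.
  apply: (affine_add aff cn) => a.
  rewrite [in LHS]ffunE (@count_cover _ _ h vs) /=.
  + rewrite big_cons /= [in RHS]ffunE; congr addn.
    rewrite big_map [RHS]big_mkcond; apply: eq_big_seq => g gg /=.
    have ole p : own g.2 p -> p < size x.
      by move=> /own_lt; rewrite -(letter_gs gg) size_map.
    case: eqP => [gi|gi].
      apply: pown_segment => p og; have := ole p og; rewrite sx => pt.
      have [pe|pe] := ltnP p e.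
        by move: og; rewrite low // gi mem_head.
      have [//|p1] := ltnP p (e + size w1).
      have := leader_owner Ld C2 cl2 gg _ og.
      by rewrite gi (negPf nis) => /(_ _)-> //; lia.
    apply: pown0 => p; rewrite own_take own_drop; apply/negP=> /andP[p1 og].
    exact: gi (own1 _ p1 _ gg og).
  + move=> [g|_]; last by rewrite /= E1.
    by rewrite inE /= => /mapP[g' gg' [->]]; rewrite map_take map_drop letter_gs.
  + move=> p; rewrite E1 size_map => pw; rewrite /= count_map -(C1 p pw).
    by congr addn; apply: eq_count => g; rewrite /= own_take own_drop pw.
- apply: (IH _ w2) => //; first move=> g gg gs'.
    move=> p pe; have [p1|p1] := ltnP p e.
      by rewrite low // inE gs' orbT.
    apply/negP=> og; have := own1 (p - e); rewrite subnKC // => /(_ _ g gg og) gi.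
    by move: nis; rewrite -gi ?gs' //; lia.
  by rewrite sx addnA.
Qed.

End Soundness.

End Base.


(** * Regularity of the base, and soundness of its consensual language *)

Section RegularBase.
Variables (S I : finType) (lam : I -> lin S) (N : I -> nat).
Implicit Types (w : seq (S + S)) (i : I) (s : seq I).

Let m := #|I|.+1.

(** The state holds letter counts saturated at [N i]. On bounded words it is exact, so an arbitrary
    property [Q] becomes a set of final states, by classical decision. *)
Lemma regular_bounded i (Q : {ffun S -> nat} -> Prop) :
  regular (A := dalpha S) (fun w => bounded N i w /\ Q (pown w)).
Proof.
pose f w : {ffun S -> 'I_(N i).+1} := [ffun a => inord (minn (N i) (pown w a))].
apply: (@regular_fold _ _ f
  (fun g l => [ffun a => inord (minn (N i) (g a + (l == inl a)))])
  (fun g => [forall a, g a < N i] && `[< Q [ffun a => nat_of_ord (g a)] >])) => [w l|w].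
  apply/ffunP => a; rewrite !ffunE -cats1 count_cat /= addn0.
  rewrite inordK ?ltnS ?geq_minl //; congr inord.
  by move: (count_mem _ w) (nat_of_bool _) => c b; lia.
have fE : (forall a, pown w a < N i) -> [ffun a => nat_of_ord (f w a)] = pown w.
  move=> b; apply/ffunP => a; rewrite [LHS]ffunE [f w]lock ffunE -lock ffunE.
  rewrite inordK ?ltnS ?geq_minl //.
  by have := b a; rewrite ffunE; lia.
split.
  move=> [b q]; apply/andP; split.
    by apply/forallP => a; have /ffunP/(_ a) := fE b; rewrite ffunE => ->; exact: b.
  by apply/asboolP; rewrite fE.
move=> /andP[/forallP h /asboolP q].
have b a : pown w a < N i.
  by have := h a; rewrite ffunE inordK ?ltnS ?geq_minl //; lia.
by rewrite fE in q.
Qed.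

Lemma regular_fill i e : regular (A := dalpha S) (fill lam N i e).
Proof.
apply: eq_regular (regular_and
  (regular_bounded i (fun v => cone (lam i) v /\ exists a, 0 < v a))
  (regular_aligned (A := dalpha S) owned #|I| (res i) e)) => w.
by split=> [[? ? ? ?]|[[? []]]].
Qed.

Lemma regular_phase i e : regular (A := dalpha S) (phase lam N i e).
Proof.
apply: eq_regular (regular_and (regular_bounded i (affine (lam i)))
  (regular_aligned (A := dalpha S) (predC owned) #|I| (res i) e)) => w.
by split=> [[? ? ?]|[[? ?]]].
Qed.

Lemma aligned_modn r e e' D : e = e' %[mod m] -> aligned m r e D -> aligned m r e' D.
Proof. by move=> E al p; rewrite -modnDml -E modnDml => /al. Qed.

Lemma leader_modn s e e' w :
  e = e' %[mod m] -> leader lam N s e w -> leader lam N s e' w.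
Proof.
elim: s e e' w => //= i s IH e e' w E [w1 [w2 [-> [b f al] L]]].
exists w1, w2; split=> //; first by split=> //; exact: aligned_modn al.
by apply: IH L; rewrite -modnDml E modnDml.
Qed.

(** The later phases depend on their offset only modulo [m], so guessing the residue of the first
    phase's length gives a finite union of concatenations. *)
Lemma regular_leader s e : regular (A := dalpha S) (leader lam N s e).
Proof.
elim: s e => [|i s IH] e.
  apply: (@regular_fold (dalpha S) _ (fun w => nilp w) (fun _ _ => false) id) => [w a|w].
    by case: w.
  by split=> [->|/nilP].
apply: eq_regular (regular_exists (fun k : 'I_m => regular_cat
  (regular_and (regular_phase i e) (regular_size (dalpha S) #|I| k))
  (IH (e + k)))) => w /=; split.
  move=> [w1 [w2 [-> ph L]]]; exists (inord (size w1 %% m)), w1, w2.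
  rewrite inordK ?ltn_mod //; split=> //.
  by apply: leader_modn L; rewrite modnDmr.
move=> [k [w1 [w2 [-> [ph sk] L]]]]; exists w1, w2; split=> //.
by apply: leader_modn L; rewrite -sk modnDmr.
Qed.

Lemma regular_base ts : regular (A := dalpha S) (base lam N ts).
Proof.
apply: regular_or; first by apply: regular_exists_in => s; exact: regular_leader.
by apply: regular_exists => i; exact: regular_fill.
Qed.

(** No type has residue 0, so a dotted block cannot start there; empty initial phases are
    skipped. *)
Lemma leader_owns0 s e w : e %% m = 0 -> leader lam N s e w -> w <> [::] -> own w 0.
Proof.
move=> e0; elim: s w => [|i s IH] w //= [w1 [w2 [-> [_ _ al]]]].
case: w1 al => [|l w1] al; first by rewrite addn0; exact: IH.
move=> _ _; have := al 0; rewrite addn0 e0 => /(_ isT).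
by rewrite dottedE /own /=; case: (owned l).
Qed.

Lemma fill_owns0 i w : fill lam N i 0 w -> own w 0 = false.
Proof. by move=> [_ _ _ al]; rewrite al // mod0n. Qed.

Lemma fill_neq0 i w : fill lam N i 0 w -> w <> [::].
Proof. by move=> [_ _ [a H] _] E; move: H; rewrite E ffunE. Qed.

Lemma tag_fills (ws : seq (seq (S + S))) :
  (forall w, w \in ws -> exists i, fill lam N i 0 w) ->
  exists gs : seq (I * seq (S + S)),
    map snd gs = ws /\ forall g, g \in gs -> fill lam N g.1 0 g.2.
Proof.
elim: ws => [|w ws IH] H; first by exists [::].
have [i fi] := H w (mem_head _ _).
have [|gs [<- G]] := IH; first by move=> v vw; apply: H; rewrite inE vw orbT.
by exists ((i, w) :: gs); split=> // g; rewrite inE => /predU1P[->|/G].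
Qed.

(** The owner of position 0 is a leader, since fillers never own it; the other words do not own it,
    hence are fillers. The empty word has no position 0 and is treated apart. *)
Lemma base_sound ts x : (forall s, s \in ts -> uniq s) ->
  consensual (base lam N ts) x -> exists2 s, s \in ts & catlang lam s x.
Proof.
move=> uts /consensualP[ws [nws Bws C]].
have [x0|x0] := eqVneq x [::].
  case: ws nws Bws {C} => // w ws _ Bws; have [Bw] := Bws w (mem_head _ _).
  rewrite x0; case: w Bws Bw => // _ [[s sts Ls] _|[i /fill_neq0]] //.
  exists s => //; rewrite -[[::]](drop0 [::]).
  by apply: (@leader_sound _ _ _ N [::] [::] _ _ s 0 [::]) => //; exact: uts.
have sx : 0 < size x by rewrite lt0n size_eq0.
have /hasP[w0 w0ws ow0] : has (own^~ 0) ws by rewrite has_count C sx.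
have [[[s sts Ls]|[i /fill_owns0 F0]] Ew0] := Bws _ w0ws; last by rewrite F0 in ow0.
have pws := perm_to_rem w0ws.
have [|gs [Evs Fgs]] := @tag_fills (rem w0 ws).
  move=> v vr; have [[[s' _ Ls']|//] Ev] := Bws v (mem_rem vr).
  have ov : own v 0.
    by apply: (leader_owns0 (e := 0) (mod0n _) Ls') => vE; move: sx; rewrite -Ev vE.
  have := C 0; rewrite sx (permP pws) /= ow0.
  by have : 0 < count (own^~ 0) (rem w0 ws); [rewrite -has_count; apply/hasP; exists v|lia].
have Lgs g : g \in gs -> map letter g.2 = x.
  move=> gg; apply: (Bws g.2 _).2; rewrite (perm_mem pws) inE -Evs.
  by rewrite (map_f snd gg) orbT.
exists s => //; rewrite -[x]drop0.
apply: (@leader_sound _ _ _ N gs x Fgs Lgs s 0 w0) => //.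
- exact: uts.
- move=> p pw; have := C p; rewrite -Ew0 size_map pw (permP pws) /= -Evs.
  by rewrite count_map.
- by move=> g /Fgs/fill_owns0 ->.
- by rewrite drop0.
- by rewrite -Ew0 size_map.
Qed.

End RegularBase.


(** * Splitting a multiset of blocks into bounded groups *)

(** Induction on the number of coordinates in which members of the set may differ. Fix a member
    [g0]: any other one either dominates it or has some coordinate [t] with a value below [g0 t],
    and fixing that value removes a free coordinate. *)
Lemma dickson (T : finType) (A : (T -> nat) -> Prop) :
  exists N, forall g, A g ->
    exists h, [/\ A h, forall t, h t <= g t & forall t, h t <= N].
Proof.
suff H n (D : {set T}) (B : (T -> nat) -> Prop) : #|D| < n ->
    (forall g g', B g -> B g' -> forall t, t \notin D -> g t = g' t) ->
    exists N, forall g, B g ->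
      exists h, [/\ B h, forall t, h t <= g t & forall t, h t <= N].
  by apply: (H #|[set: T]|.+1 [set: T]) => // g g' _ _ t; rewrite inE.
elim: n D B => // n IH D B cD BD.
have [[g0 Bg0]|nB] := pselect (exists g, B g); last first.
  by exists 0 => g Bg; case: nB; exists g.
have /choice[K HK] (tk : T * nat) : exists N, tk.1 \in D -> forall g,
    B g /\ g tk.1 = tk.2 -> exists h, [/\ B h /\ h tk.1 = tk.2,
      forall t, h t <= g t & forall t, h t <= N].
  case: tk => t k /=; case tD: (t \in D); last by exists 0.
  have [||N HN] := IH (D :\ t) (fun g => B g /\ g t = k).
  - by move: cD; rewrite (cardsD1 t) tD; lia.
  - move=> g g' [Bg gk] [Bg' gk'] u; rewrite !inE negb_and negbK => /orP[/eqP->|].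
      by rewrite gk gk'.
    exact: BD.
  - by exists N.
(* The bound dominates [g0] and the bounds of the finitely many slices below it. *)
exists (\sum_t (g0 t + \sum_(k < g0 t) K (t, nat_of_ord k))) => g Bg.
have le1 t : g0 t + \sum_(k < g0 t) K (t, nat_of_ord k) <=
    \sum_t (g0 t + \sum_(k < g0 t) K (t, nat_of_ord k)).
  by rewrite [X in _ <= X](bigD1 t) //= leq_addr.
have [/forallP le0|] := boolP [forall t, g0 t <= g t].
  by exists g0; split=> // t; apply: leq_trans (le1 t); apply: leq_addr.
rewrite negb_forall => /existsP[t]; rewrite -ltnNge => gt.
have tD : t \in D.
  by apply: contraLR gt => tD; rewrite (BD _ _ Bg Bg0 _ tD) ltnn.
have [h [[Bh _] hg hK]] := HK (t, g t) tD g (conj Bg erefl).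
exists h; split=> // u; apply: leq_trans (hK u) _; apply: leq_trans (le1 t).
by rewrite (bigD1 (Ordinal gt)) //= addnCA leq_addr.
Qed.

Lemma split_counts (T : eqType) (V : finType) (f : T -> V) (s : seq T)
    (mu : V -> nat) :
  (forall v, mu v <= count (fun t => f t == v) s) ->
  exists s1 s2, perm_eq (s1 ++ s2) s /\
    forall v, count (fun t => f t == v) s1 = mu v.
Proof.
elim: s mu => [|t s IH] mu /= H.
  by exists [::], [::]; split=> // v; have := H v; rewrite leqn0 => /eqP.
case E: (mu (f t)) => [|k].
  have [v|s1 [s2 [p12 C]]] := IH mu.
    by have := H v; case: eqP => // <-; rewrite E.
  exists s1, (t :: s2); split=> //.
  by rewrite -[t :: s2]cat1s perm_catCA /= perm_cons.
have [v|s1 [s2 [p12 C]]] := IH (fun v => mu v - (f t == v)).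
  by have := H v; lia.
exists (t :: s1), s2; split=> [|v] /=; first by rewrite perm_cons.
by rewrite C; case: eqP => [<-|_]; rewrite ?E; lia.
Qed.

Lemma sum_count (T : eqType) (V : finType) (f : T -> V) (F : V -> nat) (s : seq T) :
  \sum_(t <- s) F (f t) = \sum_v count (fun t => f t == v) s * F v.
Proof.
elim: s => [|t s IH]; first by rewrite big_nil big1.
rewrite big_cons IH /=; under [RHS]eq_bigr => v _ do rewrite mulnDl.
rewrite big_split; congr addn; rewrite (bigD1 (f t)) //= eqxx mul1n.
by rewrite big1 ?addn0 // => v; rewrite eq_sym => /negPf ->.
Qed.

Section Grouping.
Variables (S V : finType) (val : V -> S -> nat) (l : lin S).

(** The Hilbert-basis argument: the vectors of block multiplicities and period
    coefficients solving the linear system have finitely many minimal elements.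
    The constant [c] is [0] for fillers and the offset of [l] for the leader,
    [u] counts the letters outside the blocks, and [nz] asks for a nonempty group. *)
Lemma peel (c u : S -> nat) (nz : bool) :
  exists N, forall (f : nat -> V) (s : seq nat), (nz -> s <> [::]) ->
    (exists n, forall a, u a + \sum_(t <- s) val (f t) a = c a + @comb _ l n a) ->
    exists s1 s2,
    [/\ perm_eq (s1 ++ s2) s, size s1 <= N, nz -> s1 <> [::],
        exists n, forall a, u a + \sum_(t <- s1) val (f t) a = c a + @comb _ l n a &
        exists n, forall a, \sum_(t <- s2) val (f t) a = @comb _ l n a].
Proof.
pose A (g : V + 'I_(lq l) -> nat) :=
  (nz -> exists v, 0 < g (inl v)) /\
  forall a, u a + \sum_v g (inl v) * val v a = c a + comb (fun i => g (inr i)) a.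
have [N HN] := dickson A; exists (\sum_(v : V) N) => f s nzs [n En].
pose g (t : V + 'I_(lq l)) :=
  match t with inl v => count (fun t => f t == v) s | inr i => n i end.
have Ag : A g.
  split=> [/nzs|a].
    by case: s {nzs En} @g => // t s g _; exists (f t); rewrite /g /= eqxx.
  by rewrite -En; congr addn; rewrite (sum_count f (fun v => val v a)).
have [h [[hnz hE] hg hN]] := HN g Ag.
have [v|s1 [s2 [p12 C]]] := @split_counts _ V f s (fun v => h (inl v)).
  exact: (hg (inl v)).
have S1 a : \sum_(t <- s1) val (f t) a = \sum_v h (inl v) * val v a.
  by rewrite (sum_count f (fun v => val v a)); apply: eq_bigr => v _; rewrite C.
exists s1, s2; split=> //.
- have := sum_count f (fun=> 1) s1; rewrite sum1_size => ->.
  apply: leq_sum => v _.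
  by rewrite muln1 C.
- by move=> /hnz[v]; rewrite -C => /[swap] ->.
- by exists (fun i => h (inr i)) => a; rewrite S1.
(* Subtracting the small solution from the given one cancels [c] and [u], so the remainder solves
   the homogeneous system. *)
exists (fun i => n i - h (inr i)) => a.
have := En a; rewrite -(perm_big _ p12) big_cat /= S1 addnA hE -addnA.
move=> /addnI; suff -> : comb n a =
  comb (fun i => h (inr i)) a + comb (fun i => n i - h (inr i)) a by move/addnI.
by rewrite -comb_add; apply: eq_bigr => i _; rewrite subnKC ?(hg (inr i)).
Qed.

Definition vsum (f : nat -> V) (s : seq nat) : {ffun S -> nat} :=
  [ffun a => \sum_(t <- s) val (f t) a].

(** Homogeneous peeling is repeated; it stops because each peeled group is non-empty. *)
Lemma cone_groups : exists N, forall (f : nat -> V) (s : seq nat),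
  cone l (vsum f s) ->
  exists gs, perm_eq (flatten gs) s /\ forall g, g \in gs ->
    [/\ g <> [::], size g <= N & cone l (vsum f g)].
Proof.
have [N HN] := peel (fun=> 0) (fun=> 0) true; exists N => f s.
have [k] := ubnP (size s); elim: k s => // k IH s sk [n En].
case: s => [|t s] in sk En *; first by exists [::].
have [//||s1 [s2 [p12 s1N nz [n1 E1] [n2 E2]]]] := HN f (t :: s).
  by exists n => a; have := En a; rewrite ffunE !add0n.
have {}nz := nz isT.
have [||gs [pgs H]] := IH s2.
- move: sk; rewrite -(perm_size p12) size_cat.
  by case: s1 nz {p12 s1N E1} => //= t1 s1 _; lia.
- by exists n2 => a; rewrite ffunE E2.
exists (s1 :: gs); split=> /=; first by rewrite -(permPr p12) perm_cat2l.
move=> g; rewrite inE => /predU1P[->|/H//]; split=> //.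
by exists n1 => a; have := E1 a; rewrite ffunE !add0n.
Qed.

(** One inhomogeneous peel yields the leader's group, and the remainder falls under [cone_groups].
    Since [V] is finite, the bound can be made independent of [v0]. *)
Lemma affine_groups : exists N, forall (f : nat -> V) (s : seq nat) (v0 : V),
  affine l [ffun a => val v0 a + vsum f s a] ->
  exists s0 gs, [/\ perm_eq (s0 ++ flatten gs) s, size s0 <= N,
    affine l [ffun a => val v0 a + vsum f s0 a] &
    forall g, g \in gs -> [/\ g <> [::], size g <= N & cone l (vsum f g)]].
Proof.
have [N1 H1] := cone_groups.
have /choice[K HK] := fun v0 => peel (lc l) (val v0) false.
exists (N1 + \sum_v K v) => f s v0 [n En].
have [//||s1 [s2 [p12 s1K _ [n1 E1] [n2 E2]]]] := HK v0 f s.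
  by exists n => a; have := En a; rewrite !ffunE.
have [|gs [pgs H]] := H1 f s2; first by exists n2 => a; rewrite ffunE E2.
exists s1, gs; split.
- by rewrite -(permPr p12) perm_cat2l.
- by apply: leq_trans s1K _; rewrite (bigD1 v0) //= addnCA leq_addr.
- by exists n1 => a; rewrite !ffunE E1.
by move=> g /H[? ? ?]; split=> //; lia.
Qed.

End Grouping.


(** * Completeness of the base *)

Section Blocks.
Variable S : finType.
Implicit Types (x : seq S) (w : seq (S + S)) (a : S) (g : seq nat).

Lemma own_pown w p : own w p -> exists a, 0 < pown w a.
Proof.
elim: w p => [|l w IH] [|p] //=.
  by rewrite /own /=; case: l => // a _; exists a; rewrite ffunE /= eqxx.
by move=> /IH[a]; rewrite ffunE => H; exists a; rewrite ffunE /= addn_gt0 H orbT.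
Qed.

Lemma pown_mark x D a :
  pown (mark x D) a = \sum_(0 <= p < size x) D p * (onth x p == Some a).
Proof.
rewrite (@pown_sum _ _ (size x)) ?size_mark // letter_mark.
by apply: eq_big_nat => p /andP[_ px]; rewrite own_mark px andbT.
Qed.

Lemma parikh_mark x a (D1 D2 : nat -> bool) : (forall p, p < size x -> D1 p + D2 p = 1) ->
  count_mem a x = pown (mark x D1) a + pown (mark x D2) a.
Proof.
move=> H; rewrite count_onth !pown_mark -big_split.
by apply: eq_big_nat => p /andP[_ /H E]; rewrite /= -mulnDl E mul1n.
Qed.

Lemma pown_mark_add x a (D D1 D2 : nat -> bool) :
  (forall p, p < size x -> D p = D1 p + D2 p :> nat) ->
  pown (mark x D) a = pown (mark x D1) a + pown (mark x D2) a.
Proof.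
move=> H; rewrite !pown_mark -big_split.
by apply: eq_big_nat => p /andP[_ /H E]; rewrite /= -mulnDl E.
Qed.

Lemma sum_interval (n lo hi : nat) : \sum_(0 <= p < n) (lo <= p < hi) <= hi - lo.
Proof.
suff : \sum_(0 <= p < n) (lo <= p < hi) <= minn n hi - lo by lia.
elim: n => [|n IH]; first by rewrite big_geq.
by rewrite big_nat_recr //=; case: (leqP lo n) IH; case: (ltnP n hi) => /=; lia.
Qed.

Lemma pown_mark_le x a (D : nat -> bool) lo hi :
  (forall p, p < size x -> D p -> lo <= p < hi) ->
  pown (mark x D) a <= hi - lo.
Proof.
move=> H; rewrite pown_mark; apply: leq_trans (sum_interval (size x) lo hi).
rewrite big_seq [X in _ <= X]big_seq; apply: leq_sum => p.
rewrite mem_index_iota => /andP[_ /H]; case: (D p) => //= /(_ isT) ->.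
by rewrite mul1n leq_b1.
Qed.

Variables (m d : nat).
Hypothesis m_gt0 : 0 < m.

(** The positions of the blocks with indices in [g], block 0 starting at [d]. *)
Definition blk g (p : nat) : bool := (d <= p) && ((p - d) %/ m \in g).

(** The block index [(p - d) %/ m] changes only where [m] divides [p - d], that is, at positions of
    residue [r]. *)
Lemma aligned_blk r e g : r < m -> (e + d) %% m = r -> aligned m r e (blk g).
Proof.
move=> rm E [|p] ne; rewrite /blk.
  by case: d E ne => // -> /eqP.
have [dp|dp] := leqP d p; last first.
  have [dp'|//] := leqP d p.+1; have Ed : d = p.+1 by lia.
  by rewrite -Ed E eqxx in ne.
rewrite (leqW dp) /=; congr (_ \in g); rewrite subSn //.
have nd : ~~ (m %| (p - d).+1).
  apply: contra ne => /dvdnP[k Ek].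
  have -> : e + p.+1 = k * m + (e + d) by lia.
  by rewrite modnMDl E.
by rewrite divnS // (negPf nd).
Qed.

Lemma blk_nil p : blk [::] p = false.
Proof. by rewrite /blk andbF. Qed.

Lemma blk_cat g1 g2 p : uniq (g1 ++ g2) -> blk (g1 ++ g2) p = blk g1 p + blk g2 p :> nat.
Proof.
rewrite cat_uniq /blk => /and3P[_ /hasPn H _]; rewrite mem_cat.
have [_|//] := leqP d p; set q := (p - d) %/ m; rewrite /=.
by have := H q; case: (q \in g1); case: (q \in g2) => // /(_ isT).
Qed.

Lemma perm_blk g1 g2 p : perm_eq g1 g2 -> blk g1 p = blk g2 p.
Proof. by move=> /perm_mem E; rewrite /blk E. Qed.

Lemma pown_blk x g a : uniq g ->
  pown (mark x (blk g)) a = \sum_(i <- g) pown (mark x (blk [:: i])) a.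
Proof.
elim: g => [_|i g IH ug].
  by rewrite big_nil pown_mark big1 // => p _; rewrite blk_nil.
rewrite big_cons -IH; last by case/andP: ug.
by apply: pown_mark_add => p _; rewrite -(blk_cat (g1 := [:: i])).
Qed.

Lemma pown_blk1 x i a : pown (mark x (blk [:: i])) a <= m.
Proof.
have -> : m = (d + i.+1 * m) - (d + i * m) by lia.
apply: pown_mark_le => p _; rewrite /blk inE => /andP[dp /eqP <-].
have := divn_eq (p - d) m; have := ltn_pmod (p - d) m_gt0.
by set q := (_ %/ _); lia.
Qed.

Lemma blk_size x g p : {subset g <= iota 0 ((size x - d) %/ m)} ->
  blk g p -> p < size x.
Proof.
move=> gs /andP[dp /gs]; rewrite mem_iota add0n => /andP[_].
have := leq_divM (size x - d) m; set q := (_ %/ _).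
rewrite ltn_divLR //; lia.
Qed.

Lemma count_blk gs p : uniq (flatten gs) ->
  count (fun g => blk g p) gs = blk (flatten gs) p.
Proof.
elim: gs => [|g gs IH] /= ug; first by rewrite blk_nil.
by rewrite blk_cat // IH //; move: ug; rewrite cat_uniq => /and3P[].
Qed.

End Blocks.

(** The factor is cut into full blocks of residue [r] plus two short ends, and [affine_groups]
    distributes the blocks. The bound [K] precedes [e] and [x], as the base must be fixed in
    advance. *)
Lemma phase_complete (S : finType) (l : lin S) (m r : nat) : r < m ->
  exists K, forall e (x : seq S), linlang l x -> exists w fs,
  [/\ map letter w = x,
      forall p, own w p + count (fun f => own f p) fs = (p < size x),
      [/\ forall a, pown w a < K, affine l (pown w) & aligned m r e (dotted w)] &
      forall f, f \in fs -> map letter f = x /\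
        [/\ forall a, pown f a < K, cone l (pown f), exists a, 0 < pown f a &
            aligned m r e (own f)]].
Proof.
move=> rm; have m_gt0 : 0 < m by lia.
(* Entries up to [m + m] hold the counts of one block, at most [m], and also of the two ends, at
   most [m] each. *)
pose V : finType := {ffun S -> 'I_(m + m).+1}.
have [N HN] := @affine_groups S V (fun v a => v a) l.
(* At most [N] blocks, plus the two ends in the leader's case; the successor makes the bound
   strict. *)
exists ((N + 2) * m).+1 => e x [n En].
(* The first position of the factor whose absolute position [e + d] has residue [r]. *)
pose d := (r + (m - e %% m)) %% m.
have dm : d < m by rewrite ltn_mod.
have Ed : (e + d) %% m = r.
  rewrite modnDmr -modnDml; have em := ltn_pmod e m_gt0.
  have -> : e %% m + (r + (m - e %% m)) = r + m by lia.
  by rewrite modnDr modn_small.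
pose K0 := (size x - d) %/ m; pose s := iota 0 K0.
pose F i a := pown (mark x (blk m d [:: i])) a.
pose f i : V := [ffun a => inord (F i a)].
have fE i a : f i a = F i a :> nat.
  by rewrite ffunE inordK // ltnS (leq_trans (pown_blk1 _ m_gt0 _ _ _)) // leq_addr.
pose rest p := ~~ blk m d s p.
pose u a := pown (mark x rest) a.
have uE a : u a <= m + m.
  rewrite /u (@pown_mark_add _ _ _ _ (fun p => (p < d) && rest p)
                                     (fun p => (d <= p) && rest p)).
    apply: leq_add.
      apply: leq_trans (_ : d - 0 <= m); last by rewrite subn0 ltnW.
      by apply: pown_mark_le => p _ /andP[].
    apply: leq_trans (_ : (d + K0 * m + m) - (d + K0 * m) <= m); last by lia.
    apply: pown_mark_le => p px /andP[dp]; rewrite /rest /blk dp /= mem_iota add0n /=.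
    rewrite -leqNgt leq_divRL // => kp.
    have := divn_eq (size x - d) m; have := ltn_pmod (size x - d) m_gt0.
    rewrite -/K0; lia.
  by move=> p _; case: ltnP => _; rewrite /= ?addn0.
pose v0 : V := [ffun a => inord (u a)].
have v0E a : v0 a = u a :> nat by rewrite ffunE inordK // ltnS.
have us : uniq s by apply: iota_uniq.
have tot g a : uniq g -> vsum (fun (v : V) a => v a) f g a = pown (mark x (blk m d g)) a.
  by move=> ug; rewrite ffunE pown_blk //; apply: eq_bigr => i _; rewrite fE.
have [|s0 [gs [p0 s0N [n0 E0] Hgs]]] := HN f s v0.
  exists n => a; rewrite -En ffunE v0E tot // [RHS]ffunE.
  rewrite (@parikh_mark _ x a rest (blk m d s)) // => p _.
  by rewrite /rest; case: blk.
have u0 : uniq (s0 ++ flatten gs) by rewrite (perm_uniq p0).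
have us0 : uniq s0 by move: u0; rewrite cat_uniq => /and3P[].
have ugs : uniq (flatten gs) by move: u0; rewrite cat_uniq => /and3P[].
have sub (g : seq nat) : {subset g <= flatten gs} ->
    {subset g <= iota 0 ((size x - d) %/ m)}.
  by move=> h i /h; rewrite -/K0 -/s -(perm_mem p0) mem_cat orbC => ->.
have sid : {subset flatten gs <= flatten gs} by [].
have subg g : g \in gs -> {subset g <= flatten gs}.
  by move=> gg i ig; apply/flattenP; exists g.
have ug g : g \in gs -> uniq g.
  move=> gg; have := perm_to_rem gg => /perm_flatten /perm_uniq.
  by rewrite ugs /= cat_uniq => /esym/and3P[].
(* The leader keeps the ends and the group [s0]; every other group becomes one filler. *)
pose w := mark x (fun p => ~~ blk m d (flatten gs) p).
have wE a : pown w a = u a + pown (mark x (blk m d s0)) a.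
  apply: pown_mark_add => p _; rewrite /rest -(perm_blk m d p p0).
  have := blk_cat m d p u0.
  by case: (blk m d (s0 ++ _) p) (blk m d s0 p) (blk m d (flatten gs) p) => [] [] [].
have le g a : uniq g -> pown (mark x (blk m d g)) a <= size g * m.
  move=> ug'; rewrite pown_blk // -sum1_size big_distrl /= leq_sum // => i _.
  by rewrite mul1n pown_blk1.
exists w, [seq mark x (blk m d g) | g <- gs]; split.
- by rewrite letter_mark.
- move=> p; rewrite own_mark count_map.
  case: ltnP => px; last first.
    rewrite andbF add0n; apply/eqP; rewrite eqn0Ngt -has_count -all_predC.
    by apply/allP => g _; rewrite /= own_mark ltnNge px andbF.
  rewrite andbT (@eq_count _ _ (fun g => blk m d g p)).
    by rewrite count_blk //; case: blk.
  by move=> g; rewrite /= own_mark px andbT.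
- split=> [a||].
  + rewrite ltnS wE; have := uE a; have := le s0 a us0.
    by have : size s0 * m <= N * m; [rewrite leq_mul2r s0N orbT|lia].
  + by exists n0 => a; rewrite -E0 wE ffunE v0E tot.
  move=> p ne; have H := aligned_blk m_gt0 (flatten gs) rm Ed ne.
  have D q : dotted w q = blk m d (flatten gs) q.
    rewrite dottedE size_mark own_mark; case: ltnP => qx /=.
      by rewrite andbT negbK.
    by apply/esym/negP => /(blk_size m_gt0 (sub _ sid)); lia.
  by rewrite D H; case: p {ne H} => // p; rewrite D.
move=> ? /mapP[g gg ->]; rewrite letter_mark; split=> //.
have [gn gN [k Ek]] := Hgs g gg; have ugg := ug g gg.
have og q : own (mark x (blk m d g)) q = blk m d g q.
  rewrite own_mark andb_idr // => /blk_size; apply=> //.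
  exact/sub/subg.
split.
- move=> a; rewrite ltnS; apply: leq_trans (le _ _ ugg) _.
  by rewrite leq_mul2r; apply/orP; right; lia.
- by exists k => a; rewrite -Ek tot.
- case: g gn {gg gN Ek ugg k} og => // i g _ og.
  apply: (@own_pown _ _ (d + i * m)); rewrite og /blk leq_addr addKn mulnK //.
  exact: mem_head.
move=> p ne; have H := aligned_blk m_gt0 g rm Ed ne.
by rewrite og H; case: p {ne H} => // p; rewrite og.
Qed.


(** * Assembling the phases of a leader, with fillers padded by dots *)

Section Completeness.
Variables (S I : finType) (lam : I -> lin S) (N : I -> nat).
Implicit Types (x : seq S) (w : seq (S + S)).

Definition splits x w (fs : seq (seq (S + S))) : Prop :=
  [/\ map letter w = x, forall f, f \in fs -> map letter f = x &
      forall p, own w p + count (fun f => own f p) fs = (p < size x)].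

Hypothesis phase_splits : forall i e x, linlang (lam i) x ->
  exists w fs, [/\ splits x w fs, phase lam N i e w &
    forall f, f \in fs -> fill lam N i e f].

Lemma own_inr x p : own (map inr x) p = false.
Proof. by rewrite /own -map_comp; elim: x p => [|a x IH] [|p] //=. Qed.

Lemma pown_inr x a : pown (map inr x) a = 0.
Proof. by apply: pown0 => p; exact: own_inr. Qed.

Lemma letter_inr x : map letter (map inr x) = x.
Proof. by rewrite -map_comp map_id. Qed.

Lemma own_pad_right w x p : own (w ++ map inr x) p = own w p.
Proof.
by rewrite own_cat; case: ltnP => // /own_default ->; exact: own_inr.
Qed.

Lemma own_pad_left w x p :
  own (map inr x ++ w) p = (size x <= p) && own w (p - size x).
Proof. by rewrite own_cat size_map own_inr; case: ltnP. Qed.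

(** Only alignment depends on the offset, so the other clauses transfer from any offset. *)
Lemma eq_fill i e w w' : pown w = pown w' ->
  aligned #|I|.+1 (res i) e (own w') ->
  (exists e', fill lam N i e' w) -> fill lam N i e w'.
Proof.
move=> E al [e' [b c [a pa] _]]; split=> // [a'||].
- by rewrite -E; exact: b.
- by rewrite -E.
- by exists a; rewrite -E.
Qed.

Lemma fill_pad_right i e w x : fill lam N i e w -> fill lam N i e (w ++ map inr x).
Proof.
move=> F; apply: (@eq_fill _ _ w); last by exists e.
  by apply/ffunP => a; rewrite pown_cat pown_inr addn0.
case: F => _ _ _ al p /al; rewrite own_pad_right => ->.
by case: p => // p; rewrite own_pad_right.
Qed.

Lemma fill_pad_left i e w x :
  fill lam N i (e + size x) w -> fill lam N i e (map inr x ++ w).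
Proof.
move=> F; apply: (@eq_fill _ _ w); last by exists (e + size x).
  by apply/ffunP => a; rewrite pown_cat pown_inr.
case: F => _ _ _ al p ne; rewrite own_pad_left.
case: leqP => [xp|px] /=; last first.
  by case: p px {ne} => // p px; rewrite own_pad_left leqNgt ltnW.
rewrite al; last by rewrite -addnA subnKC.
case: p xp {ne} => [|p] xp; first by rewrite sub0n.
(* At the seam, the dotted padding agrees with the default [false] that alignment assumes before the
   first letter of [w]. *)
rewrite own_pad_left; have [E|ne] := eqVneq (size x) p.+1.
  by rewrite E subnn ltnn.
have -> : size x <= p by lia.
by rewrite subSn //; lia.
Qed.

Lemma splits_cat x1 x2 w1 w2 fs1 fs2 : splits x1 w1 fs1 -> splits x2 w2 fs2 ->
  splits (x1 ++ x2) (w1 ++ w2)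
    ([seq f ++ map inr x2 | f <- fs1] ++ [seq map inr x1 ++ f | f <- fs2]).
Proof.
move=> [L1 F1 C1] [L2 F2 C2]; split.
- by rewrite map_cat L1 L2.
- move=> f; rewrite mem_cat => /orP[] /mapP[g gfs ->]; rewrite map_cat letter_inr.
    by rewrite F1.
  by rewrite F2.
move=> p; rewrite count_cat !count_map own_cat size_cat.
have sw : size w1 = size x1 by rewrite -L1 size_map.
rewrite (@eq_count _ _ (fun f => own f p)); last by move=> f; rewrite /= own_pad_right.
rewrite (@eq_count _ (preim _ _) (fun f => (size x1 <= p) && own f (p - size x1)));
  last by move=> f; rewrite /= own_pad_left.
rewrite sw; case: ltnP => px /=.
  rewrite count_pred0 addn0 C1 px.
  by rewrite ltn_addr.
have -> : count (fun f => own f p) fs1 = 0.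
  by have := C1 p; rewrite ltnNge px /=; lia.
rewrite add0n C2; congr nat_of_bool; lia.
Qed.

Lemma leader_complete s e x : catlang lam s x -> exists w fs,
  [/\ splits x w fs, leader lam N s e w &
      forall f, f \in fs -> exists i, fill lam N i e f].
Proof.
elim: s e x => [|i s IH] e x /=.
  move=> ->; exists [::], [::]; split=> //; split=> // p.
  by rewrite own_default.
move=> [x1 [x2 [-> l1 l2]]].
have [w1 [fs1 [S1 P1 F1]]] := phase_splits e l1.
have [w2 [fs2 [S2 P2 F2]]] := IH (e + size x1) x2 l2.
exists (w1 ++ w2).
exists ([seq f ++ map inr x2 | f <- fs1] ++ [seq map inr x1 ++ f | f <- fs2]).
split; first exact: splits_cat.
  exists w1, w2; split=> //; suff -> : size w1 = size x1 by [].
  by case: S1 => <- _ _; rewrite size_map.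
move=> f; rewrite mem_cat => /orP[] /mapP[g gfs ->].
  by exists i; apply: fill_pad_right; exact: F1.
by have [j Fj] := F2 g gfs; exists j; exact: fill_pad_left.
Qed.

Lemma base_complete ts s x : s \in ts -> catlang lam s x ->
  consensual (base lam N ts) x.
Proof.
move=> sts /(leader_complete 0)[w [fs [[L F C] Ld Fs]]].
apply/consensualP; exists (w :: fs); split=> // v.
rewrite inE => /predU1P[->|vfs]; split=> //.
- by left; exists s.
- by right; exact: Fs.
- exact: F.
Qed.

End Completeness.

(** Duplicate-free lists give distinct residues to the factors of each product. *)
Lemma catlang_CREG (S I : finType) (lam : I -> lin S) (ts : seq (seq I)) :
  (forall s, s \in ts -> uniq s) ->
  CREG (fun x => exists2 s, s \in ts & catlang lam s x).
Proof.
move=> uts.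
have rm (i : I) : res i < #|I|.+1 by rewrite /res ltnS ltn_ord.
have /choice[N HN] := fun i => phase_complete (lam i) (rm i).
exists (base lam N ts); split; first exact: regular_base.
move=> x; split=> [[s sts cx]|]; last exact: base_sound.
apply: base_complete sts cx => i e y /(HN i e)[w [fs [L C [b a al] F]]].
exists w, fs; split; [split=> // f /F[]|split|move=> f /F[_ [? ? ? ?]]] => //.
Qed.

(** * The normal form of the family *)

(** Each list in [ts] is a product of factors. [uniq] constrains indices only: distinct indices may
    carry the same linear set. *)
Definition catform (S : finType) (L : lang S) : Prop :=
  exists (I : finType) (lam : I -> lin S) (ts : seq (seq I)),
    (forall s, s \in ts -> uniq s) /\
    forall x, L x <-> exists2 s, s \in ts & catlang lam s x.

Section Catform.
Variable S : finType.

Lemma catlang_cat (I : Type) (lam : I -> lin S) s1 s2 x :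
  catlang lam (s1 ++ s2) x <->
  exists x1 x2, [/\ x = x1 ++ x2, catlang lam s1 x1 & catlang lam s2 x2].
Proof.
elim: s1 x => [|i s1 IH] x /=.
  by split=> [H|[? [? [-> -> ?]]]]; first by exists [::], x.
split=> [[y [z [-> ly /IH[z1 [z2 [-> l1 l2]]]]]]|[z [x2 [-> [y [z2 [-> ly l1]] l2]]]]].
  by exists (y ++ z1), z2; split=> //; [rewrite catA|exists y, z1].
exists y, (z2 ++ x2); split=> //; first by rewrite catA.
by apply/IH; exists z2, x2.
Qed.

Lemma catlang_map (I J : Type) (h : I -> J) (lam : J -> lin S) s x :
  catlang lam (map h s) x <-> catlang (lam \o h) s x.
Proof.
elim: s x => //= i s IH x.
by split=> -[y [z [-> ly /IH lz]]]; exists y, z.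
Qed.

Definition sum_lin (I J : Type) (f : I -> lin S) (g : J -> lin S) (k : I + J) :=
  match k with inl i => f i | inr j => g j end.

(** The components [Ls i] need not be commutative, but since [L] is, replacing them by their
    commutative closures does not leave [L]. *)
Lemma catform_base (L : lang S) : Defs.commutative L -> semilinear_prop L -> catform L.
Proof.
move=> comL [m [Ls [LE lin_Ls]]].
have /choice[lam Hlam] (i : 'I_m) : exists l : lin S,
    forall v, (exists x, Ls i x /\ parikh x = v) <-> affine l v.
  have [c [q [p H]]] := lin_Ls i; exists (@Lin S c q p) => v.
  split=> [/H[n ->]|[n En]]; first by exists n => a; rewrite ffunE.
  by apply/H; exists n; apply/ffunP => a; rewrite En ffunE.
exists 'I_m, lam, [seq [:: i] | i <- enum 'I_m]; split.
  by move=> s /mapP[i _ ->].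
move=> x; split=> [/LE[i Lix]|[_ /mapP[i _ ->]] /= [y [_ [-> ly ->]]]].
  exists [:: i]; first by apply: map_f; rewrite mem_enum.
  exists x, [::]; rewrite cats0; split=> //; apply/Hlam; by exists x.
rewrite cats0; have /Hlam[z [Lz Ez]] := ly.
by apply/comL; exists z; split=> //; apply/LE; exists i.
Qed.

Lemma catform_union (L1 L2 L : lang S) : catform L1 -> catform L2 ->
  (forall x, L x <-> L1 x \/ L2 x) -> catform L.
Proof.
move=> [I [f [ts1 [u1 H1]]]] [J [g [ts2 [u2 H2]]]] LE.
exists (I + J)%type, (sum_lin f g), (map (map inl) ts1 ++ map (map inr) ts2); split.
  by move=> s; rewrite mem_cat => /orP[] /mapP[t tt ->]; rewrite map_inj_uniq;
    [exact: u1|move=> ? ? []|exact: u2|move=> ? ? []].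
move=> x; rewrite LE H1 H2; split.
  move=> [[s sts cs]|[s sts cs]].
    by exists (map inl s); [rewrite mem_cat map_f|apply/catlang_map].
  by exists (map inr s); [rewrite mem_cat orbC map_f|apply/catlang_map].
move=> [s]; rewrite mem_cat => /orP[] /mapP[t tt ->] /catlang_map ct.
  by left; exists t.
by right; exists t.
Qed.

(** The disjoint sum of the index types keeps the concatenated lists duplicate-free. *)
Lemma catform_cat (L1 L2 L : lang S) : catform L1 -> catform L2 ->
  (forall x, L x <-> exists x1 x2, L1 x1 /\ L2 x2 /\ x = x1 ++ x2) -> catform L.
Proof.
move=> [I [f [ts1 [u1 H1]]]] [J [g [ts2 [u2 H2]]]] LE.
exists (I + J)%type, (sum_lin f g), [seq map inl s ++ map inr t | s <- ts1, t <- ts2].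
split.
  move=> ? /allpairsP[[s t] /= [st tt ->]]; rewrite cat_uniq.
  rewrite !map_inj_uniq ?u1 ?u2 //; try by move=> ? ? [].
  by rewrite andbT; apply/hasPn => ? /mapP[j _ ->]; apply/mapP => -[].
move=> x; rewrite LE; split.
  move=> [x1 [x2 [/H1[s ss cs] [/H2[t tt ct] ->]]]].
  exists (map inl s ++ map inr t); first by apply/allpairsP; exists (s, t).
  by apply/catlang_cat; exists x1, x2; split=> //; apply/catlang_map.
move=> [? /allpairsP[[s t] /= [st tt ->]]] /catlang_cat[x1 [x2 [-> c1 c2]]].
exists x1, x2; split; [apply/H1; exists s|split=> //; apply/H2; exists t] => //.
  by move/catlang_map: c1.
by move/catlang_map: c2.
Qed.

Lemma inC_catform (L : lang S) : inC L -> catform L.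
Proof.
elim=> {L} [L|L1 L2 L _ H1 _ H2|L1 L2 L _ H1 _ H2].
- exact: catform_base.
- exact: catform_union.
- exact: catform_cat.
Qed.

(** A long word has a long factor in one of the commutative languages. *)
Lemma inC_swap (L : lang S) : inC L -> exists k, forall x, L x -> k < size x ->
  exists y u v z, x = y ++ [:: u, v & z] /\ L (y ++ [:: v, u & z]).
Proof.
elim=> {L} [L comL _|L1 L2 L _ [k1 H1] _ [k2 H2] LE|L1 L2 L _ [k1 H1] _ [k2 H2] LE].
- exists 1 => -[|u [|v z]] // Lx _; exists [::], u, v, z; split=> //.
  apply/comL; exists [:: u, v & z]; split=> //.
  by apply/ffunP => a; rewrite !ffunE /= addnCA.
- exists (k1 + k2) => x /LE[Lx|Lx] kx.
    have [|y [u [v [z [E Ly]]]]] := H1 x Lx; first by lia.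
    by exists y, u, v, z; split=> //; apply/LE; left.
  have [|y [u [v [z [E Ly]]]]] := H2 x Lx; first by lia.
  by exists y, u, v, z; split=> //; apply/LE; right.
exists (k1 + k2) => ? /LE[x1 [x2 [Lx1 [Lx2 ->]]]]; rewrite size_cat => kx.
have [k1x|xk1] := ltnP k1 (size x1).
  have [y [u [v [z [E Ly]]]]] := H1 x1 Lx1 k1x.
  exists y, u, v, (z ++ x2); rewrite E -catA; split=> //.
  by apply/LE; exists (y ++ [:: v, u & z]), x2; rewrite -catA.
have [|y [u [v [z [E Ly]]]]] := H2 x2 Lx2; first by lia.
exists (x1 ++ y), u, v, z; rewrite E -!catA; split=> //.
by apply/LE; exists x1, (y ++ [:: v, u & z]).
Qed.

End Catform.

(** * Strictness *)

Definition alternating : lang bool := fun x => x = mkseq odd (size x).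

(** In a base without dotted letters every word is already determined by its letters, so the
    consensual language is the base itself. The automaton keeps the parity of the length, with
    [None] as sink. *)
Lemma alternating_CREG : CREG alternating.
Proof.
exists (fun w => w = map inl (mkseq odd (size w))); split.
  apply: (@regular_fold (dalpha bool) _
    (fun w => if w == map inl (mkseq odd (size w)) then Some (odd (size w)) else None)
    (fun q l => if q is Some b then if l == inl b then Some (~~ b) else None else None)
    isSome) => [w l|w].
    rewrite size_rcons /mkseq -addn1 iotaD !map_cat cats1 eqseq_rcons.
    by case: eqP => //= _; case: eqP => //=; rewrite addn1.
  by case: eqP => // ->.
move=> x; split=> [xE|/consensualP[[|w ws] [// _ H _]]].
  apply/consensualP; exists [:: map inl x]; split=> // [v|p].
    rewrite inE => /eqP ->; rewrite size_map; split; last by rewrite -map_comp map_id.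
    by congr map.
  rewrite /= addn0 /own -map_comp; case: ltnP => px.
    by rewrite (nth_map false).
  by rewrite nth_default ?size_map.
have [wE <-] := H w (mem_head _ _).
by rewrite /alternating size_map {1}wE -map_comp map_id.
Qed.

Lemma alternating_notin_C : ~ inC alternating.
Proof.
move=> /inC_swap[k H].
have [y [u [v [z [E1 E2]]]]] : exists (y : seq bool) (u v : bool) (z : seq bool),
    mkseq odd k.+1 = y ++ [:: u, v & z] /\ alternating (y ++ [:: v, u & z]).
  by apply: H; rewrite /alternating size_mkseq.
have s1 := congr1 size E1; rewrite size_mkseq size_cat /= in s1.
have nthy (x : seq bool) c d t :
    x = y ++ [:: c, d & t] -> alternating x -> c = odd (size y).
  move=> -> alt; have := congr1 (nth false ^~ (size y)) alt.
  by rewrite /= nth_mkseq ?nth_cat ?ltnn ?subnn //= size_cat /=; lia.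
have alt1 : alternating (mkseq odd k.+1) by rewrite /alternating size_mkseq.
(* Both [u] and [v] equal the parity of [size y], yet in the original word [v] stands one position
   later and has the opposite parity. *)
have uE := nthy _ _ _ _ E1 alt1; have vE := nthy _ _ _ _ erefl E2.
have : nth false (mkseq odd k.+1) (size y).+1 =
    nth false (y ++ [:: u, v & z]) (size y).+1 by rewrite E1.
rewrite nth_mkseq; last by lia.
rewrite nth_cat ltnNge leqnSn /= subSnn /= vE.
by case: (odd (size y)).
Qed.

Theorem theorem4 :
  (forall (S : finType) (L : lang S), inC L -> CREG L) /\
  (exists (S : finType) (L : lang S), CREG L /\ ~ inC L).
Proof.
split=> [S L /inC_catform[I [lam [ts [uts LE]]]]|].
  have [B [rB HB]] := catlang_CREG lam uts.
  by exists B; split=> // x; rewrite LE.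
exists bool, alternating; split; first exact: alternating_CREG.
exact: alternating_notin_C.
Qed.
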